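(* Let $n$ be a positive integer, let $\mathcal{J}$ be an $n$-ary $\aleph_0$-categorical ultrahomogeneous structure in a relational language $\mathcal{L}$, and let $\mathcal{I}$ be a first-order reduct of $\mathcal{J}$ which is ultrahomogeneous in a finite relational language $\mathcal{L}'$ and which is not $n$-ary. Then $\operatorname{age}(\mathcal{I})$ is not a Ramsey class.
   Context: A structure is $n$-ary if it admits quantifier elimination in a relational language consisting only of relation symbols of arity at most $n$. A first-order reduct of $\mathcal{J}$ is a structure on the same domain all of whose relations and functions are $\emptyset$-definable in $\mathcal{J}$. A Ramsey class is a class of finite structures with the hereditary property, the joint embedding property and the Ramsey property: for all $A\subseteq B$ in the class there is $C$ in the class such that for every 2-colouring of the embeddings of $A$ into $C$ there is an embedding $B'$ of $B$ into $C$ such that all embeddings of $A$ into $C$ with image inside $B'$ have the same colour. *)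

(* Defs.v *)
From mathcomp Require Import all_boot.
From mathcomp Require Import boolp classical_sets functions cardinality.

Set Implicit Arguments.
Unset Strict Implicit.
Unset Printing Implicit Defensive.

Local Open Scope classical_set_scope.
Local Open Scope card_scope.

Record language := Language { symbol :> Type; arity : symbol -> nat }.

Definition structure (L : language) (D : Type) :=
  forall R : L, set ((arity R).-tuple D).

(* Well-scoped first-order formulas with equality: the free variables of a    *)
(* [formula L m] are indexed by ['I_m], and the variable bound by [Forall] is *)
(* variable [0] of the body, the outer variable [i] becoming [i + 1] there.   *)
Inductive formula (L : language) : nat -> Type :=
| Falsum m : formula L m
| Equal m (i j : 'I_m) : formula L m
| Atom m (R : L) (t : (arity R).-tuple 'I_m) : formula L m
| Implies m (phi psi : formula L m) : formula L m
| Forall m (phi : formula L m.+1) : formula L m.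

Fixpoint satisfies (L : language) (D : Type) (M : structure L D) (m : nat)
    (phi : formula L m) : m.-tuple D -> Prop :=
  match phi in formula _ m return m.-tuple D -> Prop with
  | Falsum _ => fun _ => False
  | Equal _ i j => fun v => tnth v i = tnth v j
  | Atom _ R t => fun v => M R (map_tuple (tnth v) t)
  | Implies _ phi psi => fun v => satisfies M phi v -> satisfies M psi v
  | Forall _ phi => fun v => forall x : D, satisfies M phi (cons_tuple x v)
  end.

Fixpoint quantifier_free (L : language) (m : nat) (phi : formula L m) : Prop :=
  match phi with
  | Implies _ phi psi => quantifier_free phi /\ quantifier_free psi
  | Forall _ _ => False
  | _ => True
  end.

Definition definable (L : language) (D : Type) (M : structure L D) (m : nat)
    (X : set (m.-tuple D)) : Prop :=
  exists phi : formula L m, forall v, X v <-> satisfies M phi v.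

Definition first_order_reduct (L L' : language) (D : Type)
    (N : structure L' D) (M : structure L D) : Prop :=
  forall R : L', definable M (N R).

Definition interdefinable (L L' : language) (D : Type)
    (M : structure L D) (N : structure L' D) : Prop :=
  first_order_reduct M N /\ first_order_reduct N M.

Definition quantifier_elimination (L : language) (D : Type)
    (M : structure L D) : Prop :=
  forall (m : nat) (phi : formula L m), exists psi : formula L m,
    quantifier_free psi /\ forall v, satisfies M phi v <-> satisfies M psi v.

(* Being n-ary does not depend on the language in which [M] is presented:     *)
(* [M] may be replaced by any structure with the same definable sets.         *)
Definition nary (n : nat) (L : language) (D : Type) (M : structure L D) : Prop :=
  exists (L0 : language) (N : structure L0 D),
    [/\ forall R : L0, arity R <= n, interdefinable M N
      & quantifier_elimination N].

Definition is_embedding (L : language) (A B : Type)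
    (a : structure L A) (b : structure L B) (f : A -> B) : Prop :=
  injective f /\ forall (R : L) (v : (arity R).-tuple A),
    a R v <-> b R (map_tuple f v).

Definition embedding (L : language) (A B : Type)
    (a : structure L A) (b : structure L B) : Type :=
  {f : A -> B | is_embedding a b f}.

Definition is_isomorphism (L : language) (A B : Type)
    (a : structure L A) (b : structure L B) (f : A -> B) : Prop :=
  is_embedding a b f /\ bijective f.

Definition substructure (L : language) (D : Type) (M : structure L D)
    (S : set D) : structure L S :=
  fun R v => M R (map_tuple val v).
Arguments substructure {L D} M S R v.

(* The language is relational, so finitely generated means finite.            *)
Definition ultrahomogeneous (L : language) (D : Type)
    (M : structure L D) : Prop :=
  forall (S T : set D) (f : S -> T), finite_set S -> finite_set T ->
    is_isomorphism (substructure M S) (substructure M T) f ->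
    exists g : D -> D,
      is_isomorphism M M g /\ forall x : S, g (val x) = val (f x).

Definition elementarily_equivalent (L : language) (A B : Type)
    (a : structure L A) (b : structure L B) : Prop :=
  forall phi : formula L 0, satisfies a phi [tuple] <-> satisfies b phi [tuple].

Definition countably_infinite_model (L : language) (D : Type)
    (M : structure L D) (A : Type) (a : structure L A) : Prop :=
  [set: A] #= [set: nat] /\ elementarily_equivalent a M.

(* The complete theory of [M] has exactly one model of cardinality aleph_0 up *)
(* to isomorphism; in particular [M] is infinite.                             *)
Definition aleph0_categorical (L : language) (D : Type)
    (M : structure L D) : Prop :=
  (exists (A : Type) (a : structure L A), countably_infinite_model M a) /\
  (forall (A B : Type) (a : structure L A) (b : structure L B),
     countably_infinite_model M a -> countably_infinite_model M b ->
     exists f : A -> B, is_isomorphism a b f).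

Definition structure_class (L : language) :=
  forall A : Type, structure L A -> Prop.

Definition age (L : language) (D : Type) (M : structure L D) :
    structure_class L :=
  fun A a => finite_set [set: A] /\ exists f : A -> D, is_embedding a M f.

Definition hereditary_property (L : language) (K : structure_class L) : Prop :=
  forall (B : Type) (b : structure L B) (S : set B),
    K B b -> K S (substructure b S).

Definition joint_embedding_property (L : language)
    (K : structure_class L) : Prop :=
  forall (A B : Type) (a : structure L A) (b : structure L B),
    K A a -> K B b ->
    exists (C : Type) (c : structure L C),
      [/\ K C c, exists f : A -> C, is_embedding a c f
        & exists g : B -> C, is_embedding b c g].

Definition ramsey_property (L : language) (K : structure_class L) : Prop :=
  forall (B : Type) (b : structure L B) (S : set B),
    let a := substructure b S in
    K B b -> K S a ->
    exists (C : Type) (c : structure L C), K C c /\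
      forall colour : embedding a c -> bool,
      exists e : embedding b c, forall f g : embedding a c,
        range (sval f) `<=` range (sval e) ->
        range (sval g) `<=` range (sval e) ->
        colour f = colour g.

Definition ramsey_class (L : language) (K : structure_class L) : Prop :=
  [/\ forall (A : Type) (a : structure L A), K A a -> finite_set [set: A],
      hereditary_property K, joint_embedding_property K & ramsey_property K].

(* Main.v *)
Require Import Defs.
From mathcomp Require Import all_boot.
From mathcomp Require Import boolp classical_sets functions cardinality.

(* If tuples of [I] with equal equality patterns and whose subtuples of length *)
(* at most [n] have equal types always satisfied the same relations, then      *)
(* homogeneity and finiteness of the language would make [I] [n]-ary. Hence    *)
(* some relation [R] separates two such tuples [v] and [w]. In a language of   *)
(* arity at most [n] with quantifier elimination, [R] is defined by a          *)
(* quantifier-free formula with finitely many atoms; these colour subtuples of *)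
(* length at most [n]. If the age of [I] were Ramsey, some copy in [I] of the  *)
(* substructure on the elements of [v] and [w] would have all colours depend   *)
(* on the [I]-type only, so that [R] could not separate the copies of [v] and  *)
(* [w].                                                                        *)

Set Implicit Arguments.
Unset Strict Implicit.
Unset Printing Implicit Defensive.

Local Open Scope classical_set_scope.

(** A Ramsey age forces [I] to be [n]-ary. By [nary_of_similar_of_small] it is enough that no
    relation [R] of [I] separates two tuples [v], [w] with the same equality pattern and the same
    types of short subtuples. Let [N] be an [n]-ary presentation of [J]: [R] has a quantifier-free
    definition in [N], and [quantifier_free_atoms] isolates its finitely many atoms. By
    [ramsey_similar_finite] the elements of [v] and [w] have a copy in [I] on which the truth of
    each of these atoms depends only on an [I]-type of length at most [n]. These types agree for [v]
    and [w], hence so does [R] on their copies, and embeddings preserve [R]. *)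

Lemma finite_set_induction (T : Type) (P : set T -> Prop) :
  P set0 -> (forall x A, P A -> P (x |` A)) -> forall A, finite_set A -> P A.
Proof.
elim/Pchoice: T P => T P P0 PU A /finite_seqP[s ->].
elim: s => [|x s IH]; first by rewrite (_ : [set` _] = set0) //; apply/predeqP => y.
rewrite (_ : [set` _] = x |` [set` s]); first exact: PU.
by apply/predeqP => y /=; rewrite inE; split=> [/predU1P|h]; last exact/predU1P.
Qed.

(** * Tuples and substitution of indices *)

Local Notation reindex x s := (map_tuple (tnth x) s).

Lemma reindexA (T : Type) (m k l : nat) (x : m.-tuple T) (s : k.-tuple 'I_m)
    (t : l.-tuple 'I_k) :
  reindex (reindex x s) t = reindex x (reindex s t).
Proof. by apply: eq_from_tnth => i; rewrite !tnth_map. Qed.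

Lemma map_reindex (T U : Type) (f : T -> U) (m k : nat) (x : m.-tuple T)
    (s : k.-tuple 'I_m) :
  map_tuple f (reindex x s) = reindex (map_tuple f x) s.
Proof. by apply: eq_from_tnth => i; rewrite !tnth_map. Qed.

Lemma map_tuple_comp (T U V : Type) (g : U -> V) (f : T -> U) (m : nat)
    (x : m.-tuple T) :
  map_tuple g (map_tuple f x) = map_tuple (g \o f) x.
Proof. by apply: eq_from_tnth => i; rewrite !tnth_map. Qed.

Lemma reindex_ord (T : Type) (m : nat) (x : m.-tuple T) :
  reindex x (ord_tuple m) = x.
Proof. by apply: eq_from_tnth => i; rewrite tnth_map tnth_ord_tuple. Qed.

Lemma reindex_cons (T : Type) (m k : nat) (a : T) (x : m.-tuple T)
    (s : k.-tuple 'I_m) :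
  reindex (cons_tuple a x) (cons_tuple ord0 (map_tuple (lift ord0) s)) =
  cons_tuple a (reindex x s).
Proof.
apply: eq_from_tnth => i; rewrite tnth_map.
by case: (unliftP ord0 i) => [j|] ->; rewrite ?tnthS ?tnth0 // !tnth_map tnthS.
Qed.

Lemma map_cons_tuple (T U : Type) (f : T -> U) (m : nat) (a : T)
    (x : m.-tuple T) :
  map_tuple f (cons_tuple a x) = cons_tuple (f a) (map_tuple f x).
Proof. exact: val_inj. Qed.

Lemma tuple_in_set (T : Type) (S : set T) (m : nat) (x : m.-tuple T) :
  range (tnth x) `<=` S -> exists x' : m.-tuple S, map_tuple val x' = x.
Proof.
move=> xS; have mem i : tnth x i \in S by apply/mem_set/xS; exists i.
exists [tuple SigSub (mem i) | i < m].
by apply: eq_from_tnth => i; rewrite tnth_map tnth_mktuple.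
Qed.

(** * Definability and quantifier-free formulas *)

Section Formulas.
Variables (L : language) (D : Type) (M : structure L D).

Definition Not m (phi : formula L m) := Defs.Implies phi (Falsum L m).
Definition Or m (phi psi : formula L m) := Defs.Implies (Not phi) psi.
Definition And m (phi psi : formula L m) := Not (Defs.Implies phi (Not psi)).

Lemma satisfies_Or m (phi psi : formula L m) v :
  satisfies M (Or phi psi) v <-> satisfies M phi v \/ satisfies M psi v.
Proof.
split=> /= [h|[p|p] //]; have [p|p] := pselect (satisfies M phi v); first by left.
by right; apply: h.
Qed.

Lemma satisfies_And m (phi psi : formula L m) v :
  satisfies M (And phi psi) v <-> satisfies M phi v /\ satisfies M psi v.
Proof.
split=> /= [h|[p q] h]; last exact: h p q.
by split; apply: contrapT => c; apply: h => p q.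
Qed.

(** Substitution of variables in formulas: under a quantifier, [s] is shifted and extended so as to
    fix the bound variable [0]. *)
Lemma definable_reindex m p (X : set (m.-tuple D)) (s : m.-tuple 'I_p) :
  definable M X -> definable M [set v | X (reindex v s)].
Proof.
move=> [phi Xphi].
suff [psi psiP] : exists psi : formula L p,
    forall v, satisfies M psi v <-> satisfies M phi (reindex v s).
  by exists psi => v; rewrite psiP -Xphi.
elim: phi p s {X Xphi} => {m} [m|m i j|m R t|m phi IHphi psi IHpsi|m phi IH] p s.
- by exists (Falsum L p).
- by exists (Equal L (tnth s i) (tnth s j)) => v /=; rewrite !tnth_map.
- by exists (Atom (reindex s t)) => v /=; rewrite reindexA.
- have [phi' phiP] := IHphi p s; have [psi' psiP] := IHpsi p s.
  by exists (Defs.Implies phi' psi') => v /=; rewrite phiP psiP.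
- have [phi' phiP] := IH p.+1 (cons_tuple ord0 (map_tuple (lift ord0) s)).
  by exists (Forall phi') => v /=; split=> h x; move: (h x);
    rewrite phiP reindex_cons.
Qed.

(** Each atom of [N] is replaced by its definition in [M], with variables substituted by
    [definable_reindex]. *)
Lemma definable_trans (L' : language) (N : structure L' D) m
    (X : set (m.-tuple D)) :
  first_order_reduct N M -> definable N X -> definable M X.
Proof.
move=> NM [phi Xphi].
suff [psi psiP] : definable M (satisfies N phi).
  by exists psi => v; rewrite Xphi psiP.
elim: phi {X Xphi} => {m} [m|m i j|m R t|m phi IHphi psi IHpsi|m phi IH].
- by exists (Falsum L m).
- by exists (Equal L i j).
- exact: definable_reindex.
- have [phi' phiP] := IHphi; have [psi' psiP] := IHpsi.
  by exists (Defs.Implies phi' psi') => v /=; rewrite phiP psiP.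
- have [phi' phiP] := IH.
  by exists (Forall phi') => v /=; split=> h x; apply/phiP; apply: h.
Qed.

(** Disjunctive normal form: the finite set [Phi] cuts the tuples into finitely many classes, and
    [X] is a union of classes. *)
Lemma invariant_qf_definable m (Phi : set (formula L m)) (X : set (m.-tuple D)) :
  finite_set Phi -> Phi `<=` @quantifier_free L m ->
  (forall v w, (forall phi, Phi phi -> satisfies M phi v <-> satisfies M phi w) ->
     X v -> X w) ->
  exists psi : formula L m,
    quantifier_free psi /\ forall v, X v <-> satisfies M psi v.
Proof.
move=> fin; elim/finite_set_induction: fin X => [|phi {}Phi IH] X qfPhi Xinv.
  have [[v Xv]|noX] := pselect (exists v, X v).
    exists (Not (Falsum L m)); split=> // w; split=> [_ //|_].
    by apply: (Xinv v) => // phi [].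
  by exists (Falsum L m); split=> // v; split=> // Xv; apply: noX; exists v.
have qfPhi' : Phi `<=` @quantifier_free L m by move=> chi Pchi; apply: qfPhi; right.
have qfphi : quantifier_free phi by apply: qfPhi; left.
(* Split [X] along [phi]; each half is [phi] (or its negation) intersected   *)
(* with the saturation of that half under agreement on the smaller set.      *)
pose agree v w := forall chi, Phi chi -> satisfies M chi v <-> satisfies M chi w.
have agree_trans u v w : agree u v -> agree v w -> agree u w.
  by move=> uv vw chi Pchi; rewrite (uv _ Pchi) (vw _ Pchi).
have saturate (Y : set (m.-tuple D)) : exists psi : formula L m,
    quantifier_free psi /\
    forall v, (exists2 u, agree u v & Y u) <-> satisfies M psi v.
  by apply: IH => // v w vw [u uv Yu]; exists u => //; apply: agree_trans vw.
have [psi1 [qf1 psi1P]] := saturate [set u | X u /\ satisfies M phi u].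
have [psi2 [qf2 psi2P]] := saturate [set u | X u /\ ~ satisfies M phi u].
exists (Or (And phi psi1) (And (Not phi) psi2)); split=> // v.
rewrite satisfies_Or !satisfies_And -psi1P -psi2P.
split=> [Xv|].
  by have [p|p] := pselect (satisfies M phi v); [left|right]; split=> //;
    exists v.
case=> -[phiv [u uv [Xu phiu]]]; apply: (Xinv u) => // chi [->|/uv//].
  by split.
by split=> [/phiu|/phiv].
Qed.

(** Only finitely many atoms occur in a formula, even if the language is infinite. Equalities need
    no place in [A], since [v] and [w] share their whole equality pattern. *)
Lemma quantifier_free_atoms m (phi : formula L m) : quantifier_free phi ->
  exists2 A : set {R : L & (arity R).-tuple 'I_m}, finite_set A &
    forall v w : m.-tuple D,
      (forall i j, tnth v i = tnth v j <-> tnth w i = tnth w j) ->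
      (forall q, A q -> M (reindex v (projT2 q)) <-> M (reindex w (projT2 q))) ->
      satisfies M phi v <-> satisfies M phi w.
Proof.
elim: phi => {m} [m _|m i j _|m R t _|m phi IHphi psi IHpsi [qfphi qfpsi]|m phi IH []].
- by exists set0 => [|v w _ _]; first exact: finite_set0.
- by exists set0 => [|v w eqvw _]; [exact: finite_set0|exact: eqvw].
- exists [set existT _ R t] => [|v w _ vw]; first exact: finite_set1.
  exact: (vw (existT _ R t)).
- have [[A finA phiA] [B finB psiB]] := (IHphi qfphi, IHpsi qfpsi).
  exists (A `|` B) => [|v w eqvw vw /=]; first by rewrite finite_setU.
  by rewrite (phiA v w) ?(psiB v w) // => q Aq; apply: vw; [right|left].
Qed.

End Formulas.

Lemma satisfies_isomorphism (L : language) (A B : Type) (a : structure L A)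
    (b : structure L B) (f : A -> B) m (phi : formula L m) v :
  is_isomorphism a b f ->
  satisfies a phi v <-> satisfies b phi (map_tuple f v).
Proof.
move=> [[injf fP] [g fK gK]].
elim: phi v => {m} [m|m i j|m R t|m phi IHphi psi IHpsi|m phi IH] v //=.
- by rewrite !tnth_map; split=> [->|/injf].
- by rewrite fP map_reindex.
- by rewrite IHphi IHpsi.
- split=> h x; last by rewrite IH map_cons_tuple.
  by rewrite -(gK x) -map_cons_tuple -IH.
Qed.

Lemma is_embedding_comp (L : language) (A B C : Type) (a : structure L A)
    (b : structure L B) (c : structure L C) (f : A -> B) (g : B -> C) :
  is_embedding a b f -> is_embedding b c g -> is_embedding a c (g \o f).
Proof.
move=> [injf fP] [injg gP]; split=> [|R v]; first exact: inj_comp.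
by rewrite fP gP map_tuple_comp.
Qed.

Lemma val_embedding (L : language) (D : Type) (M : structure L D) (S : set D) :
  is_embedding (substructure M S) M (val : S -> D).
Proof. by split=> //; apply: val_inj. Qed.

(** * Quantifier-free types, partial isomorphisms and automorphisms *)

Section Similar.
Variable L : language.

(* Equality of quantifier-free types.                                         *)
Definition similar (A B : Type) (a : structure L A) (b : structure L B) m
    (x : m.-tuple A) (y : m.-tuple B) : Prop :=
  (forall i j, tnth x i = tnth x j <-> tnth y i = tnth y j) /\
  forall (R : L) (t : (arity R).-tuple 'I_m),
    a R (reindex x t) <-> b R (reindex y t).

Lemma similar_sym A B (a : structure L A) (b : structure L B) m
    (x : m.-tuple A) (y : m.-tuple B) :
  similar a b x y -> similar b a y x.
Proof. by move=> [exy axy]; split=> *; [rewrite exy|rewrite axy]. Qed.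

Lemma similar_trans A B C (a : structure L A) (b : structure L B)
    (c : structure L C) m (x : m.-tuple A) (y : m.-tuple B) (z : m.-tuple C) :
  similar a b x y -> similar b c y z -> similar a c x z.
Proof.
move=> [exy axy] [eyz ayz].
by split=> *; [rewrite exy eyz|rewrite axy ayz].
Qed.

Lemma similar_embedding A B (a : structure L A) (b : structure L B) f m
    (x : m.-tuple A) :
  is_embedding a b f -> similar a b x (map_tuple f x).
Proof.
move=> [injf fP]; split=> [i j|R t]; last by rewrite fP map_reindex.
by rewrite !tnth_map; split=> [->|/injf].
Qed.

(** The map sending each entry of [x] to the corresponding entry of [y] is well defined and
    injective because the equality patterns agree. *)
Lemma embedding_of_similar A B (a : structure L A) (b : structure L B) m
    (x : m.-tuple A) (y : m.-tuple B) : similar a b x y ->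
  exists2 f : range (tnth x) -> B, is_embedding (substructure a _) b f &
    forall u i, val u = tnth x i -> f u = tnth y i.
Proof.
move=> [exy axy].
have idx (u : range (tnth x)) : exists i, val u = tnth x i.
  by have [i _ <-] := set_valP u; exists i.
pose h u := sval (cid (idx u)).
have hP u : val u = tnth x (h u) by exact: svalP (cid (idx u)).
have fE u i : val u = tnth x i -> tnth y (h u) = tnth y i.
  by move=> ui; apply/exy; rewrite -hP.
exists (fun u => tnth y (h u)) => //; split=> [u v /exy|R v].
  by rewrite -!hP => /val_inj.
rewrite /substructure; have -> : map_tuple val v = reindex x (map_tuple h v).
  by apply: eq_from_tnth => i; rewrite !tnth_map hP.
rewrite axy; suff -> : reindex y (map_tuple h v) =
  map_tuple (fun u => tnth y (h u)) v by [].
by apply: eq_from_tnth => i; rewrite !tnth_map.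
Qed.

Lemma finite_range_tnth A m (x : m.-tuple A) : finite_set (range (tnth x)).
Proof. exact: finite_image. Qed.

Lemma automorphism_of_similar D (M : structure L D) m (v w : m.-tuple D) :
  ultrahomogeneous M -> similar M M v w ->
  exists2 g, is_isomorphism M M g & map_tuple g v = w.
Proof.
move=> homM vw; have [f embf fE] := embedding_of_similar vw.
have fw u : f u \in range (tnth w).
  by have [i _ /esym/fE ->] := set_valP u; apply/mem_set; exists i.
(* Homogeneity extends isomorphisms between finite substructures, so [f] is first corestricted to
   its image. *)
pose f' u : range (tnth w) := SigSub (fw u).
have [f'inj f'P] : is_embedding (substructure M (range (tnth v)))
    (substructure M (range (tnth w))) f'.
  have [injf fP] := embf; split=> [u1 u2 /(congr1 val) /injf //|R t].
  by rewrite fP /substructure map_tuple_comp.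
have vi i : tnth v i \in range (tnth v) by apply/mem_set; exists i.
have [g gaut gE] : exists2 g, is_isomorphism M M g &
    forall x, g (val x) = val (f' x).
  have [||//|g [gaut gE]] := homM _ _ f'; [exact: finite_range_tnth..|split=> //|].
    have sur u : exists u', f' u' = u.
      have [i _ ui] := set_valP u; exists (SigSub (vi i)); apply: val_inj.
      by rewrite /= (fE _ i).
    exists (fun u => sval (cid (sur u))) => u; last by case: cid.
    by apply: f'inj; case: cid.
  by exists g.
exists g => //; apply: eq_from_tnth => i; rewrite tnth_map.
by rewrite -[tnth v i]/(val (SigSub (vi i))) gE /= (fE _ i).
Qed.

End Similar.

(** * A criterion for being [n]-ary *)

Section BoundedArity.
Variables (n : nat) (L : language) (D : Type) (M : structure L D).

(** Every formula in at most [n] variables becomes a relation symbol, so this expansion by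
    definitions captures all that [M] says about short tuples. *)
Definition small_language : language :=
  @Language {k : 'I_n.+1 & formula L k} (fun q => projT1 q).

Definition small_structure : structure small_language D :=
  fun q => satisfies M (projT2 q).

Definition atoms m : set (formula L m) :=
  [set Equal L p.1 p.2 | p in [set: 'I_m * 'I_m]] `|`
  \bigcup_(R in [set: L])
    [set Atom t | t in [set: (arity R).-tuple 'I_m]].

Lemma finite_atoms m : finite_set [set: L] -> finite_set (@atoms m).
Proof.
move=> finL; rewrite finite_setU; split; first exact: finite_image.
by apply: bigcup_finite => // R _; apply: finite_image.
Qed.

Lemma similar_atoms m (v w : m.-tuple D) :
  (forall phi, atoms phi -> satisfies M phi v <-> satisfies M phi w) ->
  similar M M v w.
Proof.
move=> vw; split=> [i j|R t].
  by apply: (vw (Equal L i j)); left; exists (i, j).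
by apply: (vw (Atom t)); right; exists R => //; exists t.
Qed.

(** Only the symbols that name atomic formulas of [L] are taken: this keeps the set finite, and they
    already determine the types of short subtuples. *)
Definition small_atoms m : set (formula small_language m) :=
  [set Equal small_language p.1 p.2 | p in [set: 'I_m * 'I_m]] `|`
  \bigcup_(k in [set: 'I_n.+1])
    [set (@Atom small_language m (existT _ k q.1) q.2 : formula small_language m)
       | q in @atoms k `*` [set: k.-tuple 'I_m]].

Lemma finite_small_atoms m :
  finite_set [set: L] -> finite_set (@small_atoms m).
Proof.
move=> finL; rewrite finite_setU; split; first exact: finite_image.
apply: bigcup_finite => // k _; apply: finite_image.
by apply: finite_setX => //; apply: finite_atoms.
Qed.

Lemma small_atoms_quantifier_free m :
  @small_atoms m `<=` @quantifier_free small_language m.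
Proof. by move=> phi [[p _ <-]|[k _ [q _ <-]]]. Qed.

Hypothesis (finL : finite_set [set: L]) (homM : ultrahomogeneous M).
Hypothesis similar_of_small : forall (R : L) (v w : (arity R).-tuple D),
  (forall i j, tnth v i = tnth v j <-> tnth w i = tnth w j) ->
  (forall k (s : k.-tuple 'I_(arity R)), k <= n ->
     similar M M (reindex v s) (reindex w s)) ->
  M v -> M w.

Lemma similar_of_small_atoms m (v w : m.-tuple D) :
  (forall phi, small_atoms phi ->
     satisfies small_structure phi v <-> satisfies small_structure phi w) ->
  similar M M v w.
Proof.
move=> vw.
have eqvw i j : tnth v i = tnth v j <-> tnth w i = tnth w j.
  by apply: (vw (Equal _ i j)); left; exists (i, j).
have small k (s : k.-tuple 'I_m) : k <= n ->
    similar M M (reindex v s) (reindex w s).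
  rewrite -ltnS => kn; apply: similar_atoms => phi atphi.
  apply: (vw (@Atom small_language m (existT _ (Ordinal kn) phi) s)).
  by right; exists (Ordinal kn) => //; exists (phi, s).
split=> // R t.
by split; apply: similar_of_small => [i j|k s kn]; rewrite ?tnth_map ?eqvw //;
  rewrite !reindexA; [|apply: similar_sym]; apply: small.
Qed.

Lemma invariant_small_definable m (X : set (m.-tuple D)) :
  (forall v w, similar M M v w -> X v -> X w) ->
  exists psi : formula small_language m,
    quantifier_free psi /\ forall v, X v <-> satisfies small_structure psi v.
Proof.
move=> Xinv; apply: (invariant_qf_definable (@finite_small_atoms m finL)).
  exact: small_atoms_quantifier_free.
by move=> v w /similar_of_small_atoms; apply: Xinv.
Qed.

(** A set definable in [small_structure] is definable in [M], hence invariant under automorphisms;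
    by homogeneity it is a union of quantifier-free types, so [invariant_small_definable] eliminates
    its quantifiers. *)
Lemma nary_of_similar_of_small : nary n M.
Proof.
have small_reduct : first_order_reduct small_structure M.
  by move=> [k phi]; exists phi.
exists small_language, small_structure; split.
- by move=> [k phi] /=; rewrite -ltnS.
- split=> // R; have [|psi [_ psiP]] := @invariant_small_definable _ (@M R).
    by move=> v w [_ /(_ R (ord_tuple _))]; rewrite !reindex_ord => ->.
  by exists psi.
- move=> m phi; apply: invariant_small_definable => v w vw.
  have [chi chiP] : definable M (satisfies small_structure phi).
    by apply: definable_trans small_reduct _; exists phi.
  have [g gaut <-] := automorphism_of_similar homM vw.
  by rewrite !chiP (satisfies_isomorphism _ _ gaut).
Qed.

End BoundedArity.

(** * Copies on which colours depend only on types *)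

Section Ramsey.
Variables (L : language) (D : Type) (M : structure L D).
Hypothesis ramseyM : ramsey_property (age M).

Lemma hereditary_age : hereditary_property (age M).
Proof.
move=> B b S [finB [f embf]]; split.
  by rewrite (eq_finite_set (card_setT S)); apply: sub_finite_set finB.
by exists (f \o val); apply: is_embedding_comp embf; apply: val_embedding.
Qed.

(** Tuples similar to [x] correspond to embeddings of the substructure on the entries of [x]; an
    embedding into [c] is coloured by whether it sends [x] into [X]. *)
Lemma ramsey_similar (B : Type) (b : structure L B) k (x : k.-tuple B) :
  age M b -> exists (C : Type) (c : structure L C), age M c /\
    forall X : set (k.-tuple C), exists2 e : B -> C, is_embedding b c e &
      forall y, similar b b x y -> X (map_tuple e x) <-> X (map_tuple e y).
Proof.
move=> ageb; pose S := range (tnth x).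
have [x' x'E] : exists x' : k.-tuple S, map_tuple val x' = x by exact: tuple_in_set.
have {}x'E i : val (tnth x' i) = tnth x i by rewrite -x'E tnth_map.
have [C [c [agec colC]]] := ramseyM ageb (hereditary_age S ageb).
exists C, c; split=> // X.
have [[e embe] eP] := colC (fun h => `[< X (map_tuple (sval h) x') >]).
exists e => // y xy; have [g embg gE] := embedding_of_similar xy.
have embf := is_embedding_comp (@val_embedding _ _ b S) embe.
have embg' := is_embedding_comp embg embe.
have := eP (exist _ _ embf) (exist _ _ embg').
have -> : map_tuple e x = map_tuple (e \o val) x'.
  by apply: eq_from_tnth => i; rewrite !tnth_map /= x'E.
have -> : map_tuple e y = map_tuple (e \o g) x'.
  by apply: eq_from_tnth => i; rewrite !tnth_map /= (gE _ i).
move=> H; apply: asbool_eq_equiv; apply: H => _ [u _ <-] /=.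
  by exists (val u).
by exists (g u).
Qed.

(* The types are given by tuples [z q] of [M] because the finite structure     *)
(* [b] varies in the induction: one colour is treated in [b], the others in    *)
(* the larger structure [c] provided by the Ramsey property.                   *)
Lemma ramsey_similar_finite (Q : Type) (k : Q -> nat)
    (z : forall q, (k q).-tuple D) (X : forall q, set ((k q).-tuple D))
    (A : set Q) (B : Type) (b : structure L B) :
  finite_set A -> age M b ->
  exists2 e : B -> D, is_embedding b M e &
    forall q, A q -> forall x y : (k q).-tuple B,
      similar M b (z q) x -> similar M b (z q) y ->
      X q (map_tuple e x) <-> X q (map_tuple e y).
Proof.
move=> finA; elim/finite_set_induction: finA B b => [|q {}A IH] B b ageb.
  by have [_ [e embe]] := ageb; exists e.
have [[x zx]|nox] := pselect (exists x, similar M b (z q) x); last first.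
  have [e embe eP] := IH _ _ ageb; exists e => // q' [->|Aq'] x y zx zy.
    by case: nox; exists x.
  exact: eP.
have [C [c [agec colC]]] := ramsey_similar x ageb.
(* The copy [e] of [c] serves the colours in [A]. The colour [q] is then pulled back along [e] to
   [c] and made constant on a copy [f] of [b] there. *)
have [e embe eP] := IH _ _ agec.
have [f embf fP] := colC [set y | X q (map_tuple e y)].
exists (e \o f) => [|q' [->|Aq'] y y' zy zy'].
- exact: is_embedding_comp embe.
- have fX t : similar M b (z q) t ->
      X q (map_tuple (e \o f) x) <-> X q (map_tuple (e \o f) t).
    rewrite -!(map_tuple_comp e f) => zt; apply: fP.
    exact: similar_trans (similar_sym zx) zt.
  by rewrite -(fX _ zy) (fX _ zy').
(* The colours in [A] stay good after composing with [f], since embeddings preserve types. *)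
rewrite -!(map_tuple_comp e f).
by apply: eP => //; apply: similar_trans (similar_embedding _ embf).
Qed.

End Ramsey.

Theorem theorem3p9 (n : nat) (n_gt0 : 0 < n)
    (L L' : language) (D : Type) (J : structure L D) (I : structure L' D)
    (J_nary : nary n J) (J_categorical : aleph0_categorical J)
    (J_homogeneous : ultrahomogeneous J)
    (I_reduct : first_order_reduct I J)
    (L'_finite : finite_set (@setT L'))
    (I_homogeneous : ultrahomogeneous I)
    (I_not_nary : ~ nary n I) :
  ~ ramsey_class (age I).
Proof.
move=> [_ _ _ ramseyI]; apply: I_not_nary.
apply: nary_of_similar_of_small => // R v w eqvw small IRv.
have [L0 [N [arityN [JN _] elimN]]] := J_nary.
have [phi phiP] := definable_trans JN (I_reduct R).
have [psi [qfpsi psiP]] := elimN _ phi.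
have IP u : I R u <-> satisfies N psi u by rewrite phiP psiP.
have [A finA AP] := quantifier_free_atoms N qfpsi.
pose S := range (tnth v) `|` range (tnth w).
have finS : finite_set [set: S].
  by rewrite (eq_finite_set (card_setT S)) finite_setU; split; apply: finite_range_tnth.
have ageS : age I (substructure I S).
  by split=> //; exists val; apply: val_embedding.
(* One colouring per atom of [psi]: its [N]-relation is the colour, and the [I]-type of the subtuple
   of [v] that it reads is the type to be made monochromatic. *)
have [e embe eP] := ramsey_similar_finite ramseyI
  (fun q : {R0 : L0 & (arity R0).-tuple 'I_(arity R)} => reindex v (projT2 q))
  (fun q => N (projT1 q)) finA ageS.
have [v' v'E] : exists v' : (arity R).-tuple S, map_tuple val v' = v.
  by apply: tuple_in_set => d; left.
have [w' w'E] : exists w' : (arity R).-tuple S, map_tuple val w' = w.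
  by apply: tuple_in_set => d; right.
have embval := @val_embedding _ _ I S.
have IE u : I R (map_tuple val u) <-> I R (map_tuple e u).
  by case: embe => _ <-.
rewrite -w'E IE IP; suff <- : satisfies N psi (map_tuple e v') <->
  satisfies N psi (map_tuple e w') by rewrite -IP -IE v'E.
have [injval inje] := (proj1 embval, proj1 embe).
apply: AP => [i j|[R0 t] Aq /=].
  have := eqvw i j; rewrite -v'E -w'E !tnth_map => E.
  by split=> /inje vij; congr e; apply: injval; apply/E; rewrite vij.
rewrite -!map_reindex.
have simval u : similar I (substructure I S) (reindex (map_tuple val u) t)
    (reindex u t).
  by rewrite -map_reindex; apply/similar_sym/similar_embedding.
apply: (eP _ Aq); first by rewrite -v'E; apply: simval.
(* This is where the arity bound on [N] enters: the atom reads at most [n] entries, so the subtuples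
   of [v] and [w] have the same [I]-type. *)
by apply: similar_trans (small _ t (arityN R0)) _; rewrite -w'E; apply: simval.
Qed.
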